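(* For every integer $n\ge1$, $$A_n(t,-1)=\begin{cases}(1+t)^mA_m(t), & \text{if } n=2m,\\ (1+t)^mA_{m+1}(t), & \text{if } n=2m+1.\end{cases}$$
   Context: Let $\mathfrak S_n$ be the set of permutations of $[n]=\{1,\dots,n\}$. For $\pi=\pi_1\cdots\pi_n\in\mathfrak S_n$ let $\mathrm{des}(\pi)=|\{i\in[n-1]:\pi_i>\pi_{i+1}\}|$, $\mathrm{exc}(\pi)=|\{i\in[n-1]:\pi_i>i\}|$ and $\mathrm{maj}(\pi)=\sum_{i\in[n-1],\,\pi_i>\pi_{i+1}} i$. For $n\ge1$, the Eulerian polynomial is $A_n(t)=\sum_{\pi\in\mathfrak S_n}t^{\mathrm{des}(\pi)}=\sum_{\pi\in\mathfrak S_n}t^{\mathrm{exc}(\pi)}$, and the $(\mathrm{maj},\mathrm{exc})$-Eulerian polynomial is $A_n(t,q)=\sum_{\pi\in\mathfrak S_n}t^{\mathrm{exc}(\pi)}q^{\mathrm{maj}(\pi)-\mathrm{exc}(\pi)}$; $A_n(t,-1)$ is its evaluation at $q=-1$. *)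

(* Defs.v *)
From HB Require Import structures.
From mathcomp Require Import all_boot all_order all_algebra all_fingroup.

Set Implicit Arguments.
Unset Strict Implicit.
Unset Printing Implicit Defensive.

Import GRing.Theory.

(* Permutations of [n] are elements of 'S_n, acting on {0, ..., n-1}: both
   positions and values are shifted down by one.  The shift leaves descents and
   excedances unchanged; in [maj] it is undone by summing i.+1. *)

Definition is_descent (n : nat) (s : 'S_n) (i : 'I_n) : bool :=
  [exists j : 'I_n, (j == i.+1 :> nat) && (s j < s i)].

Definition des (n : nat) (s : 'S_n) : nat := #|[set i : 'I_n | is_descent s i]|.

(* The last position is never an excedance, so i may range over all of 'I_n. *)
Definition exc (n : nat) (s : 'S_n) : nat := #|[set i : 'I_n | i < s i]|.

Definition maj (n : nat) (s : 'S_n) : nat :=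
  \sum_(i : 'I_n | is_descent s i) i.+1.

Lemma descent_after_exc (n : nat) (s : 'S_n) (i : 'I_n) :
  i < s i -> exists2 j : 'I_n, is_descent s j & i <= j.
Proof.
move=> lt_i; case: (boolP [exists j : 'I_n, is_descent s j && (i <= j)]).
  by case/existsP=> j /andP[]; exists j.
move=> /existsPn nodes; exfalso.
have grow k (j : 'I_n) : j = i + k :> nat -> s i + k <= s j.
  elim: k j => [|k IHk] j.
    by rewrite !addn0 => /val_inj ->.
  rewrite !addnS => Ej.
  have ltk : i + k < n by rewrite -Ej ltnW.
  pose j' := Ordinal ltk.
  apply: leq_ltn_trans (IHk j' erefl) _.
  have /negP := nodes j'; rewrite leq_addr andbT => ndes.
  rewrite ltn_neqAle leqNgt; apply/andP; split; last first.
    by apply/negP => lts; apply: ndes; apply/existsP; exists j; rewrite Ej eqxx.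
  apply/eqP => /val_inj /perm_inj Ejj.
  by move: Ej; rewrite -Ejj /=; apply/eqP; rewrite ltn_eqF.
have n_gt0 : 0 < n by apply: leq_trans (ltn_ord i).
have ltl : n.-1 < n by rewrite prednK.
have le_il : i <= n.-1 by rewrite -ltnS prednK.
have := grow (n.-1 - i) (Ordinal ltl) (esym (subnKC le_il)).
apply/negP; rewrite -ltnNge; apply: leq_trans (ltn_ord _) _.
by rewrite -{1}(prednK n_gt0) -{1}(subnKC le_il) -addSn leq_add2r.
Qed.

(* Hence the truncated subtraction maj s - exc s below is the true one. *)
Lemma exc_le_maj (n : nat) (s : 'S_n) : exc s <= maj s.
Proof.
rewrite /exc; have [->|[i0 i0P]] := set_0Vmem [set i : 'I_n | i < s i].
  by rewrite cards0.
rewrite inE in i0P.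
case: (@arg_maxnP _ i0 (fun i : 'I_n => i < s i) val i0P) => i iE imax.
have [j dj le_ij] := descent_after_exc iE.
apply: (@leq_trans i.+1); last first.
  rewrite /maj (bigD1 j) //=; exact: leq_trans (leq_addr _ _).
rewrite cardE -(size_map val) -[i.+1](size_iota 0); apply: uniq_leq_size.
  by rewrite map_inj_uniq ?enum_uniq //; apply: val_inj.
move=> _ /mapP[k kE ->]; rewrite mem_iota ltnS /=.
by apply: imax; rewrite mem_enum inE in kE.
Qed.

Local Open Scope ring_scope.

Definition eulerian (n : nat) : {poly int} := \sum_(s : 'S_n) 'X^(des s).

(* A_n(t, q) as a polynomial in q with coefficients in Z[t]: the outer variable
   is q and the inner one is t, so (maj_exc_eulerian n).[-1] is A_n(t, -1). *)
Definition maj_exc_eulerian (n : nat) : {poly {poly int}} :=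
  \sum_(s : 'S_n) ('X^(exc s))%:P * 'X^(maj s - exc s).

(* Main.v *)
(** At [q = -1] the sign [(-1)^maj] only sees the descents at (1-based) odd
    positions, so it is a product over the pairs of positions (2k-1, 2k).  Exchanging
    the two entries of such a pair flips the sign and preserves [exc], unless one
    of the entries is the value 2k; in that case the two orders contribute together
    [1 + t] or [t (1 + t)], according to whether the other entry x is below or above
    2k.  So the pair may be replaced by [(1 + t) t^(x > 2k)] on the permutations with
    [pi_2k = 2k].  These permute the odd values freely, which leaves the
    excedance polynomial of a symmetric group of half the size.  That excedances and
    descents are equidistributed follows from inserting the largest value: into a
    cycle, or into the word. *)

Require Import Defs.
From mathcomp Require Import all_boot all_order all_algebra all_fingroup.
From mathcomp Require Import ring zify.
Set Implicit Arguments.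
Unset Strict Implicit.
Unset Printing Implicit Defensive.
Import GRing.Theory.
Local Open Scope ring_scope.

(** * Equidistribution of excedances and descents *)

(* [ins j s] ranges over the insertions of a new maximum into [s]; [keep s j] says that
   the [j]-th one leaves the statistic unchanged, the others raise it by one. *)
Lemma sum_perm_insert (V : zmodType) (n : nat)
    (ins : 'I_n.+1 -> 'S_n -> 'S_n.+1) (stat : 'S_n.+1 -> nat) (k : 'S_n -> nat)
    (keep : 'S_n -> pred 'I_n.+1) (f : nat -> V) :
  injective (fun u : 'I_n.+1 * 'S_n => ins u.1 u.2) ->
  (forall j s, stat (ins j s) = (k s + ~~ keep s j)%N) ->
  (forall s, #|keep s| = (k s).+1) ->
  \sum_s f (stat s) = \sum_s (f (k s) *+ (k s).+1 + f (k s).+1 *+ (n - k s)).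
Proof.
move=> ins_inj statE card_keep.
have ins_bij : bijective (fun u : 'I_n.+1 * 'S_n => ins u.1 u.2).
  by apply: inj_card_bij ins_inj _; rewrite card_prod !card_Sn card_ord factS.
rewrite (reindex _ (onW_bij _ ins_bij)) /=.
rewrite -(pair_bigA _ (fun j s => f (stat (ins j s)))) exchange_big /=.
apply: eq_bigr => s _; rewrite (bigID (keep s)) /=; congr (_ + _).
  rewrite -(card_keep s) -sumr_const; apply: eq_bigr => j kj.
  by rewrite statE [keep s j]kj addn0.
have -> : (n - k s = #|predC (keep s)|)%N.
  have := cardC (keep s); rewrite card_ord card_keep addSn => -[E].
  by apply/eqP; rewrite -(eqn_add2l (k s)) E subnKC // -E leq_addr.
rewrite -sumr_const; apply: eq_bigr => j kj.
by rewrite statE kj addn1.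
Qed.

(** The new maximum enters a cycle right after [j]: [j] is sent to it, and it takes over the old
    image of [j]. The count is unchanged if [j] was an excedance already or the maximum becomes a
    fixed point; otherwise [j] is a new excedance. *)
Lemma exc_sum_recursion (V : zmodType) (n : nat) (f : nat -> V) :
  \sum_(s : 'S_n.+1) f (exc s)
    = \sum_(s : 'S_n) (f (exc s) *+ (exc s).+1 + f (exc s).+1 *+ (n - exc s)).
Proof.
pose L (s : 'S_n) := lift_perm ord_max ord_max s.
pose keep (s : 'S_n) : pred 'I_n.+1 := [pred j | (j == ord_max) || (j < L s j)%N].
have Lmax s : L s ord_max = ord_max by rewrite /L lift_perm_id.
have Llift s i : L s (lift ord_max i) = lift ord_max (s i) by rewrite /L lift_perm_lift.
have card_exc (s : 'S_n) : #|[set j : 'I_n.+1 | (j < L s j)%N]| = exc s.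
  rewrite /exc -(card_imset [set i : 'I_n | (i < s i)%N] (@lift_inj n.+1 ord_max)).
  apply: eq_card => j.
  rewrite inE; apply/idP/imsetP => [|[i]].
    case: (unliftP ord_max j) => [i ->|->]; last by rewrite Lmax ltnn.
    by rewrite Llift !lift_max => lt_i; exists i; rewrite ?inE.
  by rewrite inE => lt_i ->; rewrite Llift !lift_max.
apply: (@sum_perm_insert V n (fun j s => tperm j ord_max * L s)%g _ (@exc n) keep).
- move=> [j s] [j' s'] /= E.
  have top i u : (tperm i ord_max * L u)%g i = ord_max by rewrite permM tpermL Lmax.
  have Ej : j = j'.
    by apply: (@perm_inj _ (tperm j ord_max * L s)%g); rewrite top E top.
  move: E; rewrite -{}Ej => /mulgI E; congr (_, _).
  apply/permP => i; apply: (@lift_inj _ ord_max).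
  by rewrite -!Llift E.
- move=> j s; rewrite -card_exc /exc.
  case: (eqVneq j ord_max) => [->|nj].
    by rewrite tperm1 mul1g /keep /= eqxx addn0.
  have jn : (j < n)%N by have := ltn_ord j; move: nj; rewrite -val_eqE /=; lia.
  have -> : [set i : 'I_n.+1 | (i < (tperm j ord_max * L s)%g i)%N] = j |: [set i : 'I_n.+1 | (i < L s i)%N].
    apply/setP => i; rewrite !inE permM.
    case: tpermP => [->|->|/eqP ni /eqP nm].
    - by rewrite Lmax eqxx /=.
    - by rewrite Lmax /= ltnn eq_sym (negPf nj) /= ltnNge -ltnS ltn_ord.
    - by rewrite (negPf ni).
  by rewrite cardsU1 inE /keep /= (negPf nj) /= addnC.
- move=> s; rewrite -card_exc -[RHS]add1n.
  rewrite -(cardsE (keep s)).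
  have -> : [set x in keep s] = ord_max |: [set j : 'I_n.+1 | (j < L s j)%N].
    by apply/setP => j; rewrite !inE.
  by rewrite cardsU1 inE Lmax ltnn.
Qed.

(** [lift ord0 i] is the position [i + 1]: a descent is lost exactly when the maximum is put between
    its two entries. *)
Lemma is_descent_insert_max (n : nat) (s : 'S_n) (j : 'I_n.+1) (i : 'I_n) :
  is_descent (lift_perm j ord_max s) (lift j i)
    = is_descent s i && (lift ord0 i != j).
Proof.
apply/existsP/andP => [[k]|[/existsP[k /andP[/eqP Ek lt_k]] nij]].
  rewrite lift_perm_lift lift_max; case: (unliftP j k) => [k' ->|->].
    rewrite lift_perm_lift lift_max /= => /andP[/eqP Ek lt_k].
    have [Ek' nij] : k' = i.+1 :> nat /\ lift ord0 i != j :> nat.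
      by move: Ek; rewrite /= /bump /=; lia.
    by split=> //; apply/existsP; exists k'; rewrite Ek' eqxx.
  by rewrite lift_perm_id ltnNge ltnW ?andbF.
exists (lift j k); rewrite !lift_perm_lift !lift_max lt_k andbT.
by move: nij; rewrite -val_eqE /= /bump Ek /=; lia.
Qed.

(** The new maximum is put into the word at position [j]. The count is unchanged if it goes last or
    splits a descent. *)
Lemma des_sum_recursion (V : zmodType) (n : nat) (f : nat -> V) :
  \sum_(s : 'S_n.+1) f (des s)
    = \sum_(s : 'S_n) (f (des s) *+ (des s).+1 + f (des s).+1 *+ (n - des s)).
Proof.
pose D (s : 'S_n) := [set i | is_descent s i].
pose keep (s : 'S_n) : pred 'I_n.+1 :=
  [pred j | (j == ord_max) || (j \in lift ord0 @: D s)].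
have max_notin s : ord_max \notin lift ord0 @: D s.
  apply/imsetP => -[i]; rewrite inE => /existsP[k /andP[/eqP Ek _]] /(congr1 val).
  by move: (ltn_ord k); rewrite Ek /= /bump /=; lia.
apply: (@sum_perm_insert V n (fun j s => lift_perm j ord_max s) _ (@des n) keep).
- move=> [j s] [j' s'] /= E.
  have Ej : j = j'.
    by apply: (@perm_inj _ (lift_perm j ord_max s)); rewrite lift_perm_id E lift_perm_id.
  congr (_, _) => //; apply/permP => i; apply: (@lift_inj _ ord_max).
  by rewrite -!(lift_perm_lift j) E Ej.
- move=> j s.
  (* The maximum starts a descent unless it is last, and the only old descent it can destroy is the
     one just before [j]. *)
  have desE : des (lift_perm j ord_max s)
      = ((j != ord_max) + #|D s :\: [set i | lift ord0 i == j]|)%N.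
    rewrite /des (cardsD1 j) inE; congr (_ + _)%N.
      congr nat_of_bool; apply/existsP/idP => [[k /andP[/eqP Ek _]]|nj].
        by rewrite -val_eqE /=; move: (ltn_ord k); lia.
      have lt_j : (j.+1 < n.+1)%N.
        by move: nj (ltn_ord j); rewrite -val_eqE /=; lia.
      exists (Ordinal lt_j); rewrite eqxx /= lift_perm_id.
      rewrite ltn_neqAle leq_ord andbT (inj_eq val_inj) -[X in _ != X](lift_perm_id j ord_max s).
      by rewrite (inj_eq perm_inj) -val_eqE /=; lia.
    rewrite -(card_imset _ (@lift_inj n.+1 j)); apply: eq_card => k.
    rewrite !inE; case: (unliftP j k) => [i ->|->].
      rewrite eq_sym neq_lift is_descent_insert_max (mem_imset _ _ (@lift_inj n.+1 j)).
      by rewrite /= !inE andbC.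
    by rewrite eqxx; apply/esym/imsetP => -[i _ /eqP]; rewrite (negPf (neq_lift _ _)).
  rewrite {}desE -[des s](cardsID [set i | lift ord0 i == j] (D s)).
  rewrite addnAC; congr (_ + _)%N.
  have [->|nj] := eqVneq j ord_max.
    rewrite /keep /= eqxx /=; apply/esym/eqP; rewrite addn0 cards_eq0.
    apply/eqP/setP => i; rewrite !inE; apply/negP => /andP[Di /eqP Ei].
    by case/negP: (max_notin s); rewrite -Ei imset_f ?inE.
  rewrite /keep /= (negPf nj) /=.
  have [/imsetP[i Di ->]|nji] := boolP (j \in _).
    rewrite addn0 (_ : _ :&: _ = [set i]) ?cards1 //.
    apply/setP => k; rewrite !inE (inj_eq lift_inj) andbC.
    by case: eqVneq => // ->; move: Di; rewrite inE.
  rewrite (_ : _ :&: _ = set0) ?cards0 //.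
  apply/setP => k; rewrite !inE; apply/negP => /andP[Dk /eqP Ek].
  by case/negP: nji; rewrite -Ek imset_f ?inE.
- move=> s; rewrite -(cardsE (keep s)).
  have -> : [set x in keep s] = ord_max |: (lift ord0 @: D s).
    by apply/setP => j; rewrite !inE.
  by rewrite cardsU1 max_notin card_imset //; apply: lift_inj.
Qed.

(** Both recursions transform [f] in the same way; with [f] arbitrary, the induction hypothesis
    applies to the transformed function. *)
Lemma des_exc_equidistributed (V : zmodType) (n : nat) (f : nat -> V) :
  \sum_(s : 'S_n) f (des s) = \sum_(s : 'S_n) f (exc s).
Proof.
elim: n f => [|n IHn] f.
  by apply: eq_bigr => s _; congr f; rewrite /des /exc !eq_card0 //; case.
rewrite des_sum_recursion exc_sum_recursion.
exact: (IHn (fun k => f k *+ k.+1 + f k.+1 *+ (n - k))).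
Qed.

(** * Symmetrising over disjoint pairs of positions *)

Lemma sum_perm_swap (V : nmodType) (n : nat) (p q : 'I_n) (f : 'S_n -> V) :
  p != q ->
  \sum_s f s = \sum_(s : 'S_n | (s p < s q)%N) (f s + f (tperm p q * s)%g).
Proof.
move=> npq; rewrite (bigID (fun s : 'S_n => (s p < s q)%N)) big_split /=.
congr (_ + _); rewrite (reindex_inj (mulgI (tperm p q))) /=.
apply: eq_bigl => s; rewrite !permM tpermL tpermR -leqNgt leq_eqVlt.
by rewrite (inj_eq val_inj) (inj_eq perm_inj) (negPf npq).
Qed.

(** Swapping the entries at [p k] and [q k] affects only the [k]-th factor, so that weight matters
    only through its symmetrisation. *)
Lemma sum_perm_pairwise (R : comPzRingType) (n m : nat) (p q : 'I_m -> 'I_n)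
    (g g' : 'I_m -> 'I_n -> 'I_n -> R) :
  injective p -> injective q -> (forall k l, p k != q l) ->
  (forall k (a b : 'I_n), (a < b)%N -> g k a b + g k b a = g' k a b + g' k b a) ->
  \sum_(s : 'S_n) \prod_k g k (s (p k)) (s (q k))
    = \sum_(s : 'S_n) \prod_k g' k (s (p k)) (s (q k)).
Proof.
move=> p_inj q_inj npq gE.
(* The pairs are symmetrised one at a time: in [h j] the first [j] are done. *)
pose h j (k : 'I_m) := if (k < j)%N then g' k else g k.
suff hE j : (j <= m)%N -> \sum_(s : 'S_n) \prod_k g k (s (p k)) (s (q k))
    = \sum_(s : 'S_n) \prod_k h j k (s (p k)) (s (q k)).
  rewrite (hE m) //; apply: eq_bigr => s _; apply: eq_bigr => k _.
  by rewrite /h ltn_ord.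
elim: j => [|j IHj] lt_jm; first by [].
rewrite (IHj (ltnW lt_jm)); pose k0 := Ordinal lt_jm.
rewrite !(sum_perm_swap _ (npq k0 k0)); apply: eq_bigr => s lt_s.
pose C := \prod_(k | k != k0) h j k (s (p k)) (s (q k)).
(* Away from [k0] neither the swap nor the passage from [h j] to [h j.+1] changes anything, so [C]
   is a common factor. *)
have restE i (u : 'S_n) : (j <= i <= j.+1)%N ->
    (forall k, k != k0 -> u (p k) = s (p k) /\ u (q k) = s (q k)) ->
    \prod_k h i k (u (p k)) (u (q k)) = h i k0 (u (p k0)) (u (q k0)) * C.
  move=> i_j uE; rewrite (bigD1 k0) //=; congr (_ * _); apply: eq_bigr => k nk; have [-> ->] := uE k nk.
  rewrite /h; suff -> : (k < i)%N = (k < j)%N by [].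
  by move: nk; rewrite -val_eqE /=; lia.
have swapE k : k != k0 -> (tperm (p k0) (q k0) * s)%g (p k) = s (p k)
    /\ (tperm (p k0) (q k0) * s)%g (q k) = s (q k).
  move=> nk; have [np nq] : p k0 != p k /\ q k0 != q k.
    by rewrite (inj_eq p_inj) (inj_eq q_inj) eq_sym.
  by rewrite !permM !tpermD // eq_sym.
rewrite !restE ?leqnSn ?leqnn // -!mulrDl !permM tpermL tpermR.
by rewrite /h /= ltnn ltnSn gE.
Qed.

(** * Factoring the signed weight over consecutive positions *)

Lemma ltn_pair (n : nat) (k : 'I_n.+1./2) : (k.*2.+1 < n.+1)%N.
Proof. by have := ltn_ord k; have := odd_double_half n.+1; lia. Qed.

Lemma prod_double (R : comPzSemiRingType) (m : nat) (G : nat -> R) :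
  \prod_(0 <= i < m.*2) G i = \prod_(k < m) (G k.*2 * G k.*2.+1).
Proof.
elim: m => [|m IHm]; first by rewrite big_geq ?big_ord0.
by rewrite doubleS !big_nat_recr //= big_ord_recr /= IHm mulrA.
Qed.

Lemma prod_pairs (R : comPzSemiRingType) (n : nat) (F : 'I_n.+1 -> R) :
  (odd n.+1 -> F ord_max = 1) ->
  \prod_i F i = \prod_(k < n.+1./2) (F (inord k.*2) * F (inord k.*2.+1)).
Proof.
move=> F1; under eq_bigr do rewrite -[i in F i]inord_val.
rewrite -(big_mkord xpredT (fun i => F (inord i))) -{1}(odd_double_half n.+1).
rewrite -(prod_double _ (fun i => F (inord i))).
case: (boolP (odd n.+1)) => [odd_n|_]; last by rewrite add0n.
rewrite add1n big_nat_recr //=.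
have -> : (n.+1./2.*2 = n)%N by have := odd_double_half n.+1; rewrite odd_n => -[].
suff -> : inord n = ord_max :> 'I_n.+1 by rewrite F1 // mulr1.
by apply: val_inj; rewrite /= inordK.
Qed.

Lemma exc_sum (n : nat) (s : 'S_n) : exc s = (\sum_(i < n) (i < s i))%N.
Proof. by rewrite /exc -sum1dep_card big_mkcond. Qed.

(* Positions and values are 0-based: [a] and [b] are the entries at the positions
   [2k] and [2k+1], and the distinguished value is [2k+1]. *)
Definition pair_weight (n k : nat) (a b : 'I_n) : {poly int} :=
  (-1) ^+ (b < a)%N * (- 'X) ^+ (k.*2 < a)%N * (- 'X) ^+ (k.*2.+1 < b)%N.

Definition fixed_pair_weight (n k : nat) (a b : 'I_n) : {poly int} :=
  (1 + 'X) * 'X ^+ (k.*2.+1 < a)%N * (b == k.*2.+1 :> nat)%:R.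

Lemma pair_weight_sym (n k : nat) (a b : 'I_n) :
  (a < b)%N ->
  pair_weight k a b + pair_weight k b a = fixed_pair_weight k a b + fixed_pair_weight k b a.
Proof.
move=> ltab; rewrite /pair_weight /fixed_pair_weight ltab ltnNge ltnW //=.
(* With a single threshold [k.*2.+1], comparing [a] and [b] with it determines every exponent. *)
have lt_a : (k.*2 < a)%N = (a == k.*2.+1 :> nat) || (k.*2.+1 < a)%N by lia.
have lt_b : (k.*2 < b)%N = (b == k.*2.+1 :> nat) || (k.*2.+1 < b)%N by lia.
rewrite {}lt_a {}lt_b.
by case: (ltngtP a k.*2.+1) => ?; case: (ltngtP b k.*2.+1) => ?; rewrite /=; try ring; lia.
Qed.

Lemma sign_maj_exc_pairs (n : nat) (s : 'S_n.+1) :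
  'X ^+ exc s * (-1) ^+ (maj s - exc s)
    = \prod_(k < n.+1./2) pair_weight k (s (inord k.*2)) (s (inord k.*2.+1)).
Proof.
pose F (i : 'I_n.+1) : {poly int} :=
  (-1) ^+ (is_descent s i * i.+1)%N * (- 'X) ^+ (i < s i)%N.
transitivity (\prod_i F i).
  (* As [exc s <= maj s], the truncated difference has the parity of the sum, so each excedance
     contributes [- 'X]. *)
  rewrite -signr_odd oddB ?exc_le_maj // signr_addb !signr_odd.
  rewrite mulrCA [X in _ * X]mulrC -exprNn big_split /= !prodrXr -exc_sum; congr (_ ^+ _ * _).
  by rewrite /maj big_mkcond; apply: eq_bigr => i _; case: is_descent; rewrite ?mul1n.
rewrite prod_pairs => [|_]; last first.
  rewrite /F; suff [-> ->] : is_descent s ord_max = false /\ (@ord_max n < s ord_max)%N = false.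
    by rewrite mulr1.
  split; last by rewrite ltnNge -ltnS ltn_ord.
  by apply/existsP => -[j /andP[/eqP Ej _]]; have := ltn_ord j; rewrite Ej ltnn.
apply: eq_bigr => k _.
have lt_k := ltn_pair k.
have desE : is_descent s (inord k.*2) = (s (inord k.*2.+1) < s (inord k.*2))%N.
  apply/existsP/idP => [[j /andP[/eqP Ej]]|lt_s].
    suff -> : inord k.*2.+1 = j by [].
    by apply: val_inj; rewrite /= inordK // Ej inordK // ltnW.
  by exists (inord k.*2.+1); rewrite lt_s !inordK ?eqxx // ltnW.
rewrite /F /pair_weight desE !inordK //; last exact: ltnW.
(* A descent at the second position of the pair has even weight in [maj], so only the first one
   keeps its sign. *)
rewrite -[(-1) ^+ (_ * k.*2.+1)]signr_odd -[(-1) ^+ (_ * k.*2.+2)]signr_odd.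
by rewrite !oddM /= odd_double andbT andbF oddb expr0 mul1r.
Qed.

(** * Permutations that fix every second value *)

(** The permutations supported on the image of [h] are those transported along [h] and extended by
    the identity. *)
Lemma sum_perm_ext (V : nmodType) (T U : finType) (h : T -> U)
    (F : {perm T} -> V) (G : {perm U} -> V) :
  injective h ->
  (forall (s : {perm T}) (u : {perm U}), (forall x, u (h x) = h (s x)) ->
     (forall y, y \notin codom h -> u y = y) -> G u = F s) ->
  \sum_(u | perm_on [set y in codom h] u) G u = \sum_s F s.
Proof.
move=> h_inj GF.
pose ext (s : {perm T}) y := if [pick x | h x == y] is Some x then h (s x) else y.
have ext_h s x : ext s (h x) = h (s x).
  rewrite /ext; case: pickP => [x' /eqP /h_inj -> //|/(_ x)].
  by rewrite eqxx.
have ext_out s y : y \notin codom h -> ext s y = y.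
  rewrite /ext; case: pickP => // x /eqP <-.
  by rewrite codom_f.
have ext_cancel s : cancel (ext s) (ext s^-1%g).
  move=> y; have [/codomP[x ->]|ny] := boolP (y \in codom h).
    by rewrite !ext_h permK.
  by rewrite !ext_out.
pose Phi s : {perm U} := perm (can_inj (ext_cancel s)).
have Phi_inj : injective Phi.
  move=> s s' E; apply/permP => x; apply: h_inj; rewrite -!ext_h.
  by have := congr1 (fun u : {perm U} => u (h x)) E; rewrite !permE.
(* Surjectivity follows by counting: both sets have [#|T|] factorial elements. *)
have imPhi : [set u | perm_on [set y in codom h] u] = Phi @: setT.
  apply/esym/eqP; rewrite eqEcard; apply/andP; split.
    apply/subsetP => _ /imsetP[s _ ->]; rewrite inE; apply/subsetP => y.
    by rewrite !inE permE; apply: contraNT => /ext_out ->.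
  rewrite card_imset // cardsT cardsE card_perm cardsE card_codom //.
  rewrite (eq_card (B := perm_on [set: T])) ?card_perm ?cardsT // => s.
  by rewrite !inE; apply/esym/subsetP => y _; rewrite inE.
rewrite (eq_bigl (fun u => u \in Phi @: setT)) => [|u]; last by rewrite -imPhi inE.
rewrite big_imset /=; last by move=> ? ? _ _; apply: Phi_inj.
apply: eq_big => [s|s _]; first by rewrite inE.
by apply: GF => [x|y ny]; rewrite permE ?ext_h ?ext_out.
Qed.

(** The free points are the even 0-based indices. Doubling preserves their order, and fixed points
    are never excedances. *)
Lemma sum_exc_fix_odd (V : nmodType) (n : nat) (f : nat -> V) :
  \sum_(s : 'S_n.+1 | [forall k : 'I_n.+1./2, s (inord k.*2.+1) == inord k.*2.+1])
     f (exc s)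
  = \sum_(s : 'S_n./2.+1) f (exc s).
Proof.
pose h (k : 'I_n./2.+1) : 'I_n.+1 := inord k.*2.
have hE k : h k = k.*2 :> nat.
  by rewrite /h inordK //; have := ltn_ord k; have := odd_double_half n; lia.
have h_inj : injective h.
  by move=> k l /(congr1 val) /=; rewrite !hE => /double_inj /val_inj.
have codom_h y : (y \in codom h) = ~~ odd y.
  apply/codomP/idP => [[k ->]|even_y]; first by rewrite hE odd_double.
  have lt_y : (y./2 < n./2.+1)%N by rewrite ltnS half_leq // -ltnS.
  exists (Ordinal lt_y); apply: val_inj; rewrite /= hE /=.
  by rewrite -{1}(odd_double_half y) (negPf even_y).
rewrite -(sum_perm_ext (G := fun u => f (exc u)) h_inj) => [|s u uh uout].
  apply: eq_bigl => s; apply/forallP/subsetP => [fixs y|fixs k].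
    rewrite !inE codom_h; apply: contraNN => odd_y.
    have lt_y : (y./2 < n.+1./2)%N.
      by have := ltn_ord y; have := odd_double_half y; have := odd_double_half n.+1; lia.
    have /eqP := fixs (Ordinal lt_y).
    suff -> : inord (Ordinal lt_y).*2.+1 = y by move=> /eqP.
    apply: val_inj; rewrite /= -[in RHS](odd_double_half y) odd_y inordK //.
    by have := ltn_ord y; have := odd_double_half y; rewrite odd_y; lia.
  apply/contraT => /(fixs (inord k.*2.+1)); rewrite inE codom_h inordK /= ?odd_double //.
  exact: ltn_pair.
congr f; rewrite /exc -(card_imset _ h_inj); apply: eq_card => y.
rewrite inE; apply/idP/imsetP => [lt_y|[k]]; last first.
  by rewrite inE => lt_k ->; rewrite uh !hE ltn_double.
have [/codomP[k Ek]|/uout Ey] := boolP (y \in codom h); last by rewrite Ey ltnn in lt_y.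
by exists k; rewrite // inE; move: lt_y; rewrite Ek uh !hE ltn_double.
Qed.

(** * Evaluation at [q = -1] *)

(** Among [n.+1] one-based values, [n.+1./2] are even and [n./2.+1] are odd, which treats both
    parities of the size at once. *)
Lemma maj_exc_eulerian_N1 (n : nat) :
  (maj_exc_eulerian n.+1).[-1] = (1 + 'X) ^+ n.+1./2 * eulerian n./2.+1.
Proof.
rewrite /maj_exc_eulerian horner_sum.
transitivity (\sum_(s : 'S_n.+1)
    \prod_(k < n.+1./2) pair_weight k (s (inord k.*2)) (s (inord k.*2.+1))).
  by apply: eq_bigr => s _; rewrite !hornerE -sign_maj_exc_pairs.
have lt_k := @ltn_pair n.
pose p (k : 'I_n.+1./2) : 'I_n.+1 := inord k.*2.
pose q (k : 'I_n.+1./2) : 'I_n.+1 := inord k.*2.+1.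
transitivity (\sum_(s : 'S_n.+1) \prod_(k < n.+1./2) fixed_pair_weight k (s (p k)) (s (q k))).
  apply: (sum_perm_pairwise (p := p) (q := q) (g := fun k => @pair_weight n.+1 k)
            (g' := fun k => @fixed_pair_weight n.+1 k)).
  - move=> k l /(congr1 val) /=; rewrite !inordK ?(ltnW (lt_k _)) //.
    by move/double_inj/val_inj.
  - by move=> k l /(congr1 val) /=; rewrite !inordK // => -[] /double_inj/val_inj.
  - move=> k l; rewrite -val_eqE /= !inordK ?(ltnW (lt_k _)) //.
    by apply/eqP => /(congr1 odd); rewrite /= !odd_double.
  - by move=> k a b; apply: pair_weight_sym.
rewrite /eulerian des_exc_equidistributed -sum_exc_fix_odd mulr_sumr [RHS]big_mkcond.
apply: eq_bigr => s _; rewrite /fixed_pair_weight !big_split /=.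
rewrite prodr_const card_ord -mulrA.
(* The product of the indicators selects the permutations fixing every [k.*2.+1]. *)
case: ifPn => [/forallP fixs|/forallPn[k nfix]]; last first.
  rewrite [X in _ * (_ * X)](bigD1 k) //= (_ : _ == _ :> nat = false) ?mul0r ?mulr0 //.
  by apply/eqP => E; case/eqP: nfix; apply: val_inj; rewrite /= inordK.
rewrite [X in _ * (_ * X)]big1 => [|k _]; last first.
  by rewrite (eqP (fixs k)) inordK ?eqxx.
rewrite mulr1 exc_sum -prodrXr prod_pairs => [|_]; last first.
  by rewrite ltnNge -ltnS ltn_ord.
congr (_ * _); apply: eq_bigr => k _.
rewrite (eqP (fixs k)) ltnn mulr1 inordK ?(ltnW (lt_k k)) //.
(* The two thresholds differ only at the value [k.*2.+1], which is already taken at its own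
   position. *)
suff -> : (k.*2 < s (inord k.*2))%N = (k.*2.+1 < s (inord k.*2))%N by [].
suff : s (inord k.*2) != k.*2.+1 :> nat by lia.
rewrite -[X in _ != X](@inordK n) // -(eqP (fixs k)) (inj_eq val_inj).
rewrite (inj_eq perm_inj) -val_eqE /= !inordK ?(ltnW (lt_k k)) //.
by rewrite neq_ltn ltnSn.
Qed.

Theorem theorem2p2 (n : nat) (hn : (1 <= n)%N) (m : nat) :
  (n = (2 * m)%N ->
     (maj_exc_eulerian n).[-1] = (1 + 'X) ^+ m * eulerian m) /\
  (n = (2 * m + 1)%N ->
     (maj_exc_eulerian n).[-1] = (1 + 'X) ^+ m * eulerian m.+1).
Proof.
case: n hn => // n _; rewrite maj_exc_eulerian_N1; split=> En.
  have -> : (n.+1./2 = m)%N by lia.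
  by have -> : (n./2.+1 = m)%N by lia.
have -> : (n.+1./2 = m)%N by lia.
by have -> : (n./2 = m)%N by lia.
Qed.
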